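(* Let $\mathcal{H}$ be a real separable Hilbert space, let $\mathcal{D}(F)\subset\mathcal{H}$ be open, and let $F:\mathcal{D}(F)\to\mathcal{H}$ be a demicontinuous, bounded operator which is monotone on a closed convex set $\mathcal{M}\subset\mathcal{D}(F)$. Let $f_*\in\mathcal{H}$ be such that the equation $Fu=f_*$ has a solution belonging to $\mathcal{M}$. Assume that $F$ is Fréchet differentiable on $\mathcal{D}(F)$ and that, for some finite constant $L\ge 0$, $$\|F'(u)-F'(v)\|\le L\|u-v\|\quad\text{for all }u,v\in\mathcal{M}.$$ Suppose that $F$ is cocoercive on $\mathcal{M}$, and that there are $u_*\in\mathcal{M}$ and $z\in\mathcal{H}$ with $$Fu_*=f_*,\qquad u_*=F'(u_* )^*z,\qquad \varrho:=\|z\|,\qquad \varrho L<2.$$ For each $\delta>0$ let $f^\delta\in\mathcal{H}$ satisfy $\|f_*-f^\delta\|\le\delta$, and for $\alpha>0$ let $u_\alpha^\delta\in\mathcal{M}$ be the (unique) element satisfying $$\langle Fu_\alpha^\delta+\alpha u_\alpha^\delta-f^\delta,\,v-u_\alpha^\delta\rangle\ge 0\quad\text{for all }v\in\mathcal{M}.$$ Then for any a priori parameter choice $\alpha(\delta)>0$ with $\alpha(\delta)\sim\delta^{2/3}$, $$\|u_{\alpha(\delta)}^\delta-u_*\|=\mathcal{O}(\delta^{1/3})\quad\text{as }\delta\to 0.$$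
   Context: Let $\langle\cdot,\cdot\rangle$ and $\|\cdot\|$ denote the inner product and norm of $\mathcal{H}$ (and $\|\cdot\|$ also the operator norm); $F'(u)$ is the Fréchet derivative (a bounded linear operator on $\mathcal{H}$) and $F'(u)^*$ its Hilbert space adjoint. The notation $\alpha(\delta)\sim\delta^{2/3}$ means that there are constants $c_1,c_2>0$ with $c_1\delta^{2/3}\le\alpha(\delta)\le c_2\delta^{2/3}$ for all sufficiently small $\delta>0$. The (generally nonlinear) operator $F:\mathcal{D}(F)\to\mathcal{H}$ is called: - monotone on $\mathcal{M}\subset\mathcal{D}(F)$ if $\langle Fu-Fv,u-v\rangle\ge 0$ for all $u,v\in\mathcal{M}$; - cocoercive on $\mathcal{M}\subset\mathcal{D}(F)$ if there is a constant $\tau>0$ with $\langle Fu-Fv,u-v\rangle\ge\tau\|Fu-Fv\|^2$ for all $u,v\in\mathcal{M}$; - demicontinuous if for each $v\in\mathcal{D}(F)$ and each sequence $(v_n)\subset\mathcal{D}(F)$ with $v_n\to v$ in norm, $Fv_n\rightharpoonup Fv$ weakly; - bounded if it maps bounded subsets of $\mathcal{D}(F)$ to bounded subsets of $\mathcal{H}$. *)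

(* Defs.v *)
From HB Require Import structures.
From mathcomp Require Import all_boot all_order all_algebra.
From mathcomp Require Import all_classical all_reals all_analysis.

Set Implicit Arguments.
Unset Strict Implicit.
Unset Printing Implicit Defensive.

Import Order.TTheory GRing.Theory Num.Theory.
Import numFieldNormedType.Exports.

Local Open Scope classical_set_scope.
Local Open Scope ring_scope.

HB.mixin Record NormedModule_hasInner (R : realType) H of NormedModule R H := {
  inner : H -> H -> R ;
  innerC : forall x y, inner x y = inner y x ;
  innerDl : forall x y z, inner (x + y) z = inner x z + inner y z ;
  innerZl : forall (a : R) x y, inner (a *: x) y = a * inner x y ;
  inner_norm : forall x, inner x x = `|x| ^+ 2
}.

#[short(type="hilbertType")]
HB.structure Definition Hilbert (R : realType) :=
  {H of CompleteNormedModule R H & NormedModule_hasInner R H}.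

Definition separable (T : topologicalType) : Prop :=
  exists2 S : set T, countable S & dense S.

(* An operator F : D(F) -> H is encoded as a total function F : H -> H together
   with its domain D : set H; no definition below looks at F outside D. *)
Section operators.
Context {R : realType} {H : hilbertType R}.
Implicit Types (D M : set H) (F : H -> H).

Definition monotone_on M F : Prop :=
  forall u v, M u -> M v -> 0 <= inner (F u - F v) (u - v).

Definition cocoercive_on M F : Prop :=
  exists2 tau : R, 0 < tau &
    forall u v, M u -> M v ->
      tau * `|F u - F v| ^+ 2 <= inner (F u - F v) (u - v).

Definition weak_cvg (x_ : nat -> H) (x : H) : Prop :=
  forall w : H, inner (x_ n) w @[n --> \oo] --> inner x w.

Definition demicontinuous_on D F : Prop :=
  forall (v : H) (v_ : nat -> H), D v -> (forall n, D (v_ n)) ->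
    v_ n @[n --> \oo] --> v -> weak_cvg (F \o v_) (F v).

Definition bounded_operator_on D F : Prop :=
  forall B : set H, B `<=` D -> bounded_set B -> bounded_set (F @` B).

(* Meaningful for bounded linear A only: [sup] is 0 on unbounded sets. *)
Definition opnorm (A : H -> H) : R :=
  sup [set `|A x| | x in [set x : H | `|x| <= 1]].

(* The identity determines B from A; for bounded linear A such a B exists. *)
Definition is_adjoint (A B : H -> H) : Prop :=
  forall x y, inner (A x) y = inner x (B y).

(* u is the regularized solution u_alpha^delta for the data g = f^delta. *)
Definition regularized_solution M F (alpha : R) (g u : H) : Prop :=
  M u /\ forall v, M v -> 0 <= inner (F u + alpha *: u - g) (v - u).

End operators.

Definition asymp_power {R : realType} (alpha : R -> R) (p : R) : Prop :=
  exists c1 c2 : R, [/\ 0 < c1, 0 < c2 &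
    \forall d \near 0^'+, c1 * d `^ p <= alpha d <= c2 * d `^ p].

(* Main.v *)
Require Import Defs.
From HB Require Import structures.
From mathcomp Require Import all_boot all_order all_algebra.
From mathcomp Require Import all_classical all_reals all_analysis.
From mathcomp Require Import ring lra.

Import Order.TTheory GRing.Theory Num.Theory.
Import numFieldNormedType.Exports.

Local Open Scope classical_set_scope.
Local Open Scope ring_scope.

(* Put w = u - us, where u is the regularized solution. Testing the variational
   inequality with us and writing -<us, w> = -<z, F'(us) w>, the Taylor bound
   <z, F u - F us - F'(us) w> <= rho L |w|^2 / 2 and cocoercivity give
     tau |F u - F us|^2 + alpha (1 - rho L / 2) |w|^2
       <= delta |w| + alpha rho |F u - F us|.
   Young's inequality absorbs |F u - F us|, and what remains is a quadratic
   inequality for |w| which alpha ~ delta^(2/3) balances at |w| ~ delta^(1/3). *)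

Section inner_product.
Context {R : realType} {H : hilbertType R}.
Implicit Types x y z : H.

Lemma innerDr x y z : inner z (x + y) = inner z x + inner z y.
Proof. by rewrite innerC innerDl !(innerC z). Qed.

Lemma innerZr (a : R) x z : inner z (a *: x) = a * inner z x.
Proof. by rewrite innerC innerZl (innerC z). Qed.

Lemma innerNr x z : inner z (- x) = - inner z x.
Proof. by rewrite -scaleN1r innerZr mulN1r. Qed.

Lemma innerNl x z : inner (- x) z = - inner x z.
Proof. by rewrite innerC innerNr innerC. Qed.

Lemma innerBr x y z : inner z (x - y) = inner z x - inner z y.
Proof. by rewrite innerDr innerNr. Qed.

Lemma innerBl x y z : inner (x - y) z = inner x z - inner y z.
Proof. by rewrite innerDl innerNl. Qed.

(** Cauchy-Schwarz: the squared norm of |y| x - |x| y expands to 2 |x| |y| (|x| |y| - <x, y>), and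
    the positive factor is divided out. *)
Lemma inner_le_norm x y : inner x y <= `|x| * `|y|.
Proof.
have [->|x0] := eqVneq x 0.
  by rewrite -(scale0r y) innerZl scale0r normr0 !mul0r.
have [->|y0] := eqVneq y 0.
  by rewrite -(scale0r x) innerZr scale0r normr0 mul0r mulr0.
have nx : 0 < `|x| by rewrite normr_gt0.
have ny : 0 < `|y| by rewrite normr_gt0.
have := sqr_ge0 (`| `|y| *: x - `|x| *: y|).
rewrite -inner_norm innerBl !innerBr !innerZl !innerZr (innerC y) !inner_norm.
have xy : 0 < 2 * (`|x| * `|y|) by rewrite !mulr_gt0.
move=> sq; rewrite -subr_ge0 -(pmulr_rge0 _ xy).
by apply: le_trans sq _; rewrite le_eqVlt; apply/orP; left; apply/eqP; ring.
Qed.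

Lemma norm_inner_le x y : `|inner x y| <= `|x| * `|y|.
Proof. by rewrite ler_norml inner_le_norm lerNl -innerNl -(normrN x) inner_le_norm. Qed.

Lemma continuous_inner z : continuous (inner z : H -> R).
Proof.
move=> x; apply/cvgrPdist_le => e e0.
(* The added 1 keeps the divisor positive when [z] is zero. *)
have z1 : 0 < `|z| + 1 by rewrite ltr_wpDl.
near=> y; rewrite -innerBr (le_trans (norm_inner_le _ _))//.
apply: (@le_trans _ _ ((`|z| + 1) * `|x - y|)).
  by rewrite ler_wpM2r// lerDl.
rewrite -ler_pdivlMl//; near: y.
by apply: cvgr_dist_le => //; rewrite mulr_gt0// invr_gt0.
Unshelve. all: by end_near. Qed.

End inner_product.

Section differential_calculus.
Context {R : realType} {H : hilbertType R}.
Implicit Types (M : set H) (F : H -> H).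

(** The bound by [C] makes the supremum in [opnorm] a genuine upper bound; homogeneity then reduces
    to the unit vector x / |x|. *)
Lemma le_opnorm (A : H -> H) (C : R) :
  (forall x, `|A x| <= C * `|x|) -> (forall (a : R) x, A (a *: x) = a *: A x) ->
  forall x, `|A x| <= opnorm A * `|x|.
Proof.
move=> AC AZ x; have [->|x0] := eqVneq x 0.
  by rewrite -(scale0r 0) AZ !scale0r normr0 mulr0.
have nx : 0 < `|x| by rewrite normr_gt0.
rewrite -ler_pdivrMr// mulrC -(ger0_norm (normr_ge0 x)) -normfV -normrZ -AZ.
apply: sup_upper_bound; last first.
  by exists (`|x|^-1 *: x) => //=; rewrite normrZ normfV normr_id mulVf ?gt_eqF.
split; first by exists `|A 0|, 0 => //=; rewrite normr0.
exists `|C| => _ [y /= y1 <-]; apply: le_trans (AC y) _.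
apply: le_trans (ler_wpM2r (normr_ge0 y) (ler_norm C)) _.
by rewrite -[leRHS]mulr1 ler_wpM2l.
Qed.

Lemma le_opnorm_diffB F (a b : H) : differentiable F a -> differentiable F b ->
  forall x, `|'d F a x - 'd F b x| <= opnorm ('d F a \- 'd F b) * `|x|.
Proof.
move=> Fa Fb.
have bnd y : differentiable F y -> exists C : R, forall x, `|'d F y x| <= C * `|x|.
  move=> /diff_continuous/linear_bounded_continuous/linear_boundedP.
  by case/pinfty_ex_gt0 => C _ HC; exists C.
have [[C1 C1P] [C2 C2P]] := (bnd a Fa, bnd b Fb).
apply: (le_opnorm _ (C1 + C2)) => [x|k x] /=; last first.
  by rewrite scalerBr (linearZ_LR ('d F a)) (linearZ_LR ('d F b)).
by rewrite (le_trans (ler_normB _ _))// mulrDl lerD.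
Qed.

(** The difference quotient is [inner z] of the quotient of [F] in direction [w], so continuity of
    [inner z] passes to the limit. *)
Lemma is_derive_inner_line F (a w z : H) (t : R) :
  differentiable F (a + t *: w) ->
  is_derive t 1 (fun s : R => inner z (F (a + s *: w)))
    (inner z ('d F (a + t *: w) w)).
Proof.
move=> dF; set g := fun s : R => _.
have cv : (fun h : R => h^-1 *: ((g \o shift t) (h *: (1 : R)) - g t)) @ 0^' -->
    inner z ('d F (a + t *: w) w).
  rewrite -deriveE// [X in X @ _](_ : _ = inner z \o
    (fun h : R => h^-1 *: ((F \o shift (a + t *: w)) (h *: w) - F (a + t *: w)))).
    exact: continuous_cvg (continuous_inner _ _) (diff_derivable dF).
  apply/funext => h /=; rewrite innerZr innerBr /g /=; congr (_ * (inner z (F _) - _)).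
  by rewrite [_ *: 1]mulr1 scalerDl addrCA.
by apply: DeriveDef; [apply/cvg_ex; eexists; exact: cv|exact: cvg_lim cv].
Qed.

(** The mean value theorem, applied to a scalar function on the segment from [a] to [b], which
    convexity keeps inside [M]. *)
Lemma inner_taylor_le M F (L : R) (a b z : H) :
  convex_set M -> M a -> M b -> (forall x, M x -> differentiable F x) ->
  (forall x, M x -> opnorm ('d F x \- 'd F a) <= L * `|x - a|) ->
  inner z (F b - F a - 'd F a (b - a)) <= `|z| * L / 2 * `|b - a| ^+ 2.
Proof.
move=> cM Ma Mb dF lip; set w := b - a; set c := `|z| * L / 2 * `|w| ^+ 2.
have seg (t : R) : 0 <= t <= 1 -> M (a + t *: w).
  move=> /andP[t0 t1].
  have := cM b a (Itv01 t0 t1); rewrite !inE => /(_ Mb Ma).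
  by congr M; rewrite /conv /= /w scalerBr scalerBl scale1r addrCA.
(* The claim amounts to psi(1) <= psi(0). The derivative 2 c t of the quadratic term equals |z| L t
   |w|^2, the Lipschitz bound at distance t |w| from [a]; this produces the factor 1/2. *)
pose psi (t : R) := inner z (F (a + t *: w)) - t * inner z ('d F a w) - c * t ^+ 2.
pose dpsi (t : R) :=
  inner z ('d F (a + t *: w) w) - inner z ('d F a w) - c * (2 * t).
have dpsiP (t : R) : 0 <= t <= 1 -> is_derive t 1 psi (dpsi t).
  move=> /seg/dF/is_derive_inner_line dFt; have {}dFt := dFt z.
  have d1 : is_derive t (1 : R) (fun s : R => s * inner z ('d F a w))
      (inner z ('d F a w)).
    by apply: is_derive_eq; rewrite scaler0 add0r [_ *: 1]mulr1.
  have d2 : is_derive t (1 : R) (fun s : R => c * s ^+ 2) (c * (2 * t)).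
    by apply: is_derive_eq; rewrite [t%:A]mulr1 -mulr2n mulr_natl.
  exact: is_deriveB.
have [t] : exists2 t, t \in `]0, 1[%R & psi 1 - psi 0 = dpsi t * (1 - 0).
  apply: MVT => [|t|]; first exact: ltr01.
    by rewrite in_itv/= => /andP[/ltW t0 /ltW t1]; apply: dpsiP; rewrite t0.
  apply: derivable_within_continuous => t; rewrite in_itv/= => /dpsiP dt.
  exact: ex_derive.
rewrite in_itv/= => /andP[/ltW t0 /ltW t1] mvt.
have Mt : M (a + t *: w) by apply: seg; rewrite t0.
have : dpsi t <= 0.
  rewrite /dpsi -innerBr subr_le0 (le_trans (inner_le_norm _ _))//.
  have -> : c * (2 * t) = `|z| * (L * (t * `|w|) * `|w|) by rewrite /c; field.
  rewrite ler_wpM2l// (le_trans (le_opnorm_diffB _ _ _ (dF _ Mt) (dF _ Ma) w))//.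
  rewrite ler_wpM2r// (le_trans (lip _ Mt))//.
  by rewrite [_ + _ - a]addrC addKr normrZ ger0_norm.
move: mvt; rewrite subr0 mulr1 => <-; rewrite /psi scale1r scale0r addr0.
have -> : a + w = b by exact: subrKC.
by rewrite !innerBr; lra.
Qed.

End differential_calculus.

(** If x <= s, the summand 1 suffices. Otherwise s^2 <= s x bounds the right side by (p + q) s x,
    and one factor x cancels. *)
Lemma quadratic_le_bound (R : realType) (k p q x s : R) :
  0 < k -> 0 <= p -> 0 <= q -> 0 <= s ->
  k * x ^+ 2 <= p * s * x + q * s ^+ 2 -> x <= ((p + q) / k + 1) * s.
Proof.
move=> k0 p0 q0 s0 quad; rewrite mulrDl mul1r.
have C0 : 0 <= (p + q) / k * s by rewrite mulr_ge0// divr_ge0 ?addr_ge0// ltW.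
have [xs|sx] := leP x s; first by rewrite (le_trans xs)// lerDr.
have x0 : 0 < x by exact: le_lt_trans sx.
suff xC : x <= (p + q) / k * s by rewrite (le_trans xC)// lerDl.
rewrite mulrAC ler_pdivlMr// -(ler_pM2r x0).
have -> : x * k * x = k * x ^+ 2 by ring.
apply: le_trans quad _; rewrite !mulrDl lerD2l expr2 mulrA.
by rewrite ler_wpM2l ?mulr_ge0// ltW.
Qed.

Section error_estimate.
Context {R : realType} {H : hilbertType R}.
Variables (M : set H) (F : H -> H) (L tau : R) (us z : H) (Fadj : H -> H).
Hypotheses (cM : convex_set M) (Mus : M us).
Hypothesis dF : forall x, M x -> differentiable F x.
Hypothesis lip : forall x, M x -> opnorm ('d F x \- 'd F us) <= L * `|x - us|.
Hypothesis tau_gt0 : 0 < tau.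
Hypothesis coco : forall u v, M u -> M v ->
  tau * `|F u - F v| ^+ 2 <= inner (F u - F v) (u - v).
Hypotheses (adjP : is_adjoint ('d F us) Fadj) (source : us = Fadj z).

(** The estimate for fixed noise level and parameter, before any coupling of [alpha] to [delta]. *)
Lemma regularized_error_le (g u : H) (delta alpha : R) :
  0 < alpha -> `|F us - g| <= delta -> regularized_solution M F alpha g u ->
  alpha * ((1 - `|z| * L / 2) * `|u - us| ^+ 2) <=
    delta * `|u - us| + alpha ^+ 2 * (`|z| ^+ 2 / (4 * tau)).
Proof.
move=> alpha_gt0 noise [Mu vi]; set w := u - us.
have taylor := inner_taylor_le _ _ _ _ _ z cM Mus Mu dF lip; rewrite -/w in taylor.
have srcE : inner us w = inner z ('d F us w).
  by rewrite (innerC z) adjP -source innerC.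
have cs : - inner z (F u - F us) <= `|z| * `|F u - F us|.
  by rewrite -innerNl -(normrN z) inner_le_norm.
have cc := coco _ _ Mu Mus; rewrite -/w in cc.
(* The variational inequality at v = [us]; the data enter only through <g - F us, w>. *)
have test : inner (F u - F us) w + alpha * inner u w <= delta * `|w|.
  have := vi us Mus; rewrite -(opprB u us) -/w innerNr oppr_ge0 => viw.
  have gw : inner (g - F us) w <= delta * `|w|.
    rewrite (le_trans (inner_le_norm _ _))// ler_wpM2r//.
    by rewrite distrC.
  by move: viw gw; rewrite !innerBl innerDl innerZl; lra.
have uw : inner u w = inner us w + `|w| ^+ 2.
  by rewrite -inner_norm -innerDl /w subrKC.
rewrite {}uw {}srcE in test; rewrite innerBr in taylor.
set d := `|F u - F us| in cs cc; set zA := inner z _ in test taylor.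
(* Here -<z, F'(us) w> is the Taylor remainder tested with [z], minus <z, F u - F us>. *)
have src : - alpha * zA <= alpha * (`|z| * L / 2 * `|w| ^+ 2 + `|z| * d).
  by rewrite mulNr -mulrN ler_pM2l//; lra.
(* The weight is chosen so that the term in d^2 is exactly the one supplied by cocoercivity. *)
have young : alpha * `|z| * d <=
    tau * d ^+ 2 + alpha ^+ 2 * (`|z| ^+ 2 / (4 * tau)).
  rewrite -subr_ge0 (_ : _ - _ = (2 * tau * d - alpha * `|z|) ^+ 2 / (4 * tau)).
    by rewrite divr_ge0 ?sqr_ge0// mulr_ge0// ltW.
  by field; rewrite gt_eqF.
move: test src young cc; rewrite -/d; lra.
Qed.

End error_estimate.

Theorem corollary4p8 (R : realType) (H : hilbertType R)
  (H_separable : separable H)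
  (D M : set H) (F : H -> H)
  (D_open : open D)
  (F_demicontinuous : demicontinuous_on D F)
  (F_bounded : bounded_operator_on D F)
  (M_closed : closed M) (M_convex : convex_set M) (M_sub_D : M `<=` D)
  (F_monotone : monotone_on M F)
  (fs : H) (fs_solvable : exists2 u, M u & F u = fs)
  (F_differentiable : forall u, D u -> differentiable F u)
  (L : R) (L_ge0 : 0 <= L)
  (dF_lipschitz : forall u v, M u -> M v ->
    opnorm ('d F u \- 'd F v) <= L * `|u - v|)
  (F_cocoercive : cocoercive_on M F)
  (us z : H) (Mus : M us) (Fus : F us = fs)
  (dFus_adj : H -> H) (dFus_adjP : is_adjoint ('d F us) dFus_adj)
  (us_source : us = dFus_adj z)
  (rho : R) (rhoE : rho = `|z|) (rhoL : rho * L < 2)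
  (fd : R -> H)
  (fd_noise : forall delta : R, 0 < delta -> `|fs - fd delta| <= delta)
  (u : R -> R -> H)
  (u_solution : forall delta alpha : R, 0 < delta -> 0 < alpha ->
    regularized_solution M F alpha (fd delta) (u alpha delta))
  (alpha : R -> R)
  (alpha_gt0 : forall delta : R, 0 < delta -> 0 < alpha delta)
  (alpha_choice : asymp_power alpha (2 / 3)) :
  (fun delta : R => `|u (alpha delta) delta - us|) =O_ (0^'+)
    (fun delta : R => delta `^ 3^-1).
Proof.
have [c1 [c2 [c1_gt0 c2_gt0 alpha_bnd]]] := alpha_choice.
have [tau tau_gt0 coco] := F_cocoercive.
(* The smallness condition on [rho * L] makes the coefficient of |w|^2 positive. *)
pose k := 1 - `|z| * L / 2; have k_gt0 : 0 < k by rewrite /k -rhoE; lra.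
pose q := c2 * (`|z| ^+ 2 / (4 * tau)).
have q_ge0 : 0 <= q.
  by rewrite mulr_ge0 ?divr_ge0 ?sqr_ge0 ?mulr_ge0// ltW.
apply/eqOP; near=> K; near=> delta.
have delta_gt0 : 0 < delta by near: delta; exact: nbhs_right_gt.
have /andP[] : c1 * delta `^ (2 / 3) <= alpha delta <= c2 * delta `^ (2 / 3).
  by near: delta.
(* In terms of [s], the noise level is s^3 and the parameter lies between c1 s^2 and c2 s^2. *)
set s := delta `^ 3^-1; have s_gt0 : 0 < s by exact: powR_gt0.
have -> : delta `^ (2 / 3) = s ^+ 2.
  by rewrite -powR_mulrn ?ltW// -powRrM mulrC.
have deltaE : delta = s ^+ 3.
  by rewrite -powR_mulrn ?ltW// -powRrM mulVf// powRr1// ltW.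
set al := alpha delta => al_ge al_le; have al_gt0 : 0 < al by exact: alpha_gt0.
rewrite normr_id (gtr0_norm s_gt0).
(* This is the constant of [quadratic_le_bound] with p = 1 / c1; it is independent of [delta], so a
   large [K] dominates it. *)
apply: (@le_trans _ _ (((c1^-1 + q) / k + 1) * s)); last first.
  by rewrite ler_pM2r//; near: K; exact: nbhs_pinfty_ge.
apply: quadratic_le_bound => //; rewrite ?invr_ge0 ?(ltW c1_gt0) ?(ltW s_gt0)//.
set w := u al delta - us.
rewrite -(ler_pM2l al_gt0).
apply: le_trans (@regularized_error_le _ _ M F L tau us z dFus_adj
  M_convex Mus _ _ tau_gt0 coco dFus_adjP us_source _ _ delta _ al_gt0 _
  (u_solution _ _ delta_gt0 al_gt0)) _.
- by move=> x /M_sub_D/F_differentiable.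
- by move=> x Mx; exact: dF_lipschitz.
- by rewrite Fus fd_noise.
(* The lower bound on [al] gives s^3 <= al s / c1 for the noise term; the upper bound gives al^2 <=
   al c2 s^2 for the other. *)
rewrite -/w mulrDr lerD//.
  rewrite 2!mulrA ler_wpM2r// deltaE exprSr ler_wpM2r ?(ltW s_gt0)//.
  by rewrite ler_pdivlMr// mulrC.
rewrite expr2 -mulrA ler_wpM2l ?(ltW al_gt0)// /q (mulrAC c2) ler_wpM2r//.
by rewrite divr_ge0 ?sqr_ge0 ?mulr_ge0// ltW.
Unshelve. all: by end_near. Qed.
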